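(* Let $d\ge2$, $L\in\mathbb{N}$, and let $f:[0,1)^d\to[0,\infty)$ be an $L$-piecewise constant probability density. Let $X_1,X_2,\dots$ be i.i.d. with density $f$ and let $\ell(\{X_1,\dots,X_n\})$ be the length of a longest chain in $\{X_1,\dots,X_n\}$. Then \[\liminf_{n\to\infty}n^{-1/d}\ell(\{X_1,\dots,X_n\})\ge c_d\bar J\quad\text{almost surely.}\]
   Context: $x\leqq y$ means $x_i\le y_i$ for all $i$; a chain is a subset totally ordered by $\leqq$. For a multiindex $\alpha$ with integer entries $1\le\alpha_i\le L$, $Q_{L,\alpha}=\{x\in[0,1)^d:\alpha-(1,\dots,1)\leqq Lx<\alpha\}$ (strict inequality componentwise); $f$ is $L$-piecewise constant if it is constant on each $Q_{L,\alpha}$. Extend $f$ by $0$ outside $[0,1)^d$. $\mathcal{A}$ is the set of $\gamma\in C^1([0,1];\mathbb{R}^d)$ with all components of $\gamma'(t)$ nonnegative and $\gamma'(t)\ne0$ for every $t$; $J(\gamma)=\int_0^1 f(\gamma(t))^{1/d}(\gamma_1'(t)\cdots\gamma_d'(t))^{1/d}dt$ and $\bar J=\sup_{\gamma\in\mathcal{A}}J(\gamma)$. $c_d$ is the positive constant such that, for i.i.d. uniform points on $[0,1]^d$, $n^{-1/d}$ times the length of a longest chain among the first $n$ points converges almost surely to $c_d$. *)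

(* Defs.v *)
From HB Require Import structures.
From mathcomp Require Import all_boot all_order all_algebra.
From mathcomp Require Import all_classical all_reals all_analysis.
Set Implicit Arguments. Unset Strict Implicit. Unset Printing Implicit Defensive.
Import Order.TTheory GRing.Theory Num.Theory.
Import numFieldNormedType.Exports.
Local Open Scope classical_set_scope.
Local Open Scope ring_scope.

Section defs.
Variables (R : realType) (d : nat).

Definition pt := 'I_d -> R.

Definition leqv (x y : pt) : bool := [forall i, x i <= y i].

Definition longest_chain (n : nat) (x : 'I_n -> pt) : nat :=
  \max_(S : {set 'I_n} |
        [forall i in S, forall j in S,
           (leqv (x i) (x j) || leqv (x j) (x i)) &&
           ([forall k, x i k == x j k] ==> (i == j))]) #|S|.

Definition unit_cube : set pt := [set x | forall i, 0 <= x i < 1].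

(* the cell Q_{L,alpha}, indexed by k = alpha - (1,...,1) *)
Definition cell (L : nat) (k : 'I_d -> 'I_L) : set pt :=
  [set x | forall i, (k i)%:R <= L%:R * x i < (k i).+1%:R].

Definition piecewise_constant (L : nat) (f : pt -> R) : Prop :=
  forall (k : 'I_d -> 'I_L) (x y : pt), cell k x -> cell k y -> f x = f y.

Definition overlap (a b c e : R) : R :=
  Num.max 0 (Num.min b e - Num.max a c).

(* Lebesgue integral of an L-piecewise constant f (vanishing outside [0,1)^d)
   over the half-open box prod_i [a_i, b_i): sum over cells of
   (value of f on the cell) * (volume of box ∩ cell). *)
Definition pc_box_integral (L : nat) (f : pt -> R) (a b : pt) : R :=
  \sum_(k : {ffun 'I_d -> 'I_L})
     f (fun i => (k i)%:R / L%:R) *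
     \prod_(i < d) overlap (a i) (b i) ((k i)%:R / L%:R) ((k i).+1%:R / L%:R).

Definition unif_box (a b : pt) : R := \prod_(i < d) overlap (a i) (b i) 0 1.

(* X_0, X_1, ... are i.i.d. with law mu, where mu a b is the probability of
   the half-open box prod_i [a_i,b_i): the joint law of (X_0,...,X_{n-1}) on
   products of boxes is the product of the mu's. Since such products of boxes
   form a pi-system generating the Borel sets of (R^d)^n, this is exactly
   "i.i.d. with common law mu". *)
Definition iid_boxlaw dT (T : measurableType dT) (P : probability T R)
  (X : nat -> T -> pt) (mu : pt -> pt -> R) : Prop :=
  (forall m i, measurable_fun setT (fun w => X m w i)) /\
  forall (n : nat) (a b : 'I_n -> pt),
    P [set w | forall (m : 'I_n) (i : 'I_d), a m i <= X m w i < b m i]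
    = (\prod_(m < n) mu (a m) (b m))%:E.

(* the class A of admissible curves: gamma : [0,1] -> R^d, C^1, with
   nonnegative and nonvanishing derivative (curves are given on R; only their
   restriction to [0,1] matters, derivatives are taken at points of [0,1]) *)
Definition admissible (g : 'I_d -> R -> R) : Prop :=
  (forall j t, t \in `[0, 1] -> derivable (g j) t 1) /\
  (forall j, {within `[0, 1], continuous derive1 (g j)}) /\
  (forall j t, t \in `[0, 1] -> 0 <= derive1 (g j) t) /\
  (forall t, t \in `[0, 1] -> exists j, derive1 (g j) t != 0).

Definition Jintegrand (f : pt -> R) (g : 'I_d -> R -> R) (t : R) : R :=
  (f (fun j => g j t)) `^ (d%:R^-1) *
  (\prod_(j < d) derive1 (g j) t) `^ (d%:R^-1).

Definition Jfun (f : pt -> R) (g : 'I_d -> R -> R) : \bar R :=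
  \int[lebesgue_measure]_(t in `[0%R, 1%R]) (Jintegrand f g t)%:E.

Definition Jbar (f : pt -> R) : \bar R :=
  ereal_sup [set Jfun f g | g in admissible].

Definition scaled_chain (X : nat -> pt) (n : nat) : R :=
  (n%:R) `^ (- d%:R^-1) * (longest_chain (fun m : 'I_n => X m))%:R.

End defs.

(* Main.v *)
Require Import Defs.
From HB Require Import structures.
From mathcomp Require Import all_boot all_order all_algebra.
From mathcomp Require Import all_classical all_reals all_analysis.
From mathcomp Require Import measurable_realfun.
From mathcomp Require Import ring lra.
Import Order.TTheory GRing.Theory Num.Theory.
Import numFieldNormedType.Exports.
Local Open Scope classical_set_scope.
Local Open Scope ring_scope.
Set Implicit Arguments. Unset Strict Implicit. Unset Printing Implicit Defensive.

(* Fix an admissible curve [g] and, for each cell [k], the interval of times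
   [[a_k, b_k]] spent in it. By AM-GM the integral of [(prod_i g_i')^(1/d)] over it is at
   most [(prod_i (g_i b_k - g_i a_k))^(1/d)], so [J g] is bounded by the sum over [k] of
   [p_k^(1/d)], where [p_k] is the probability of the box with corners [g a_k] and [g b_k];
   neither Riemann sums nor a refining partition is needed. These boxes are mutually
   ordered, so longest chains inside them concatenate. Inside a cell the density is
   constant, hence the successive points falling in one box are, after rescaling, i.i.d.
   uniform and their chains are governed by [cd]; a Chernoff bound with Borel-Cantelli
   shows that eventually at least [q n] of the first [n] points fall in the box, for every
   [q < p_k]. The supremum over curves is reached along a sequence, so that countably many
   null sets suffice. *)

(** * Box law and chains *)

Section BoxLaw.
Context {R : realType} {d : nat}.
Implicit Types (a b x : pt R d).

Definition inbox a b x : bool := [forall i, a i <= x i < b i].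

Lemma overlap_sub (a b c e : R) :
  c <= a -> b <= e -> overlap a b c e = Num.max 0 (b - a).
Proof. by move=> ca be; rewrite /overlap (min_idPl be) (max_idPl ca). Qed.

Lemma overlap_eq0 (a b c e : R) :
  b <= c \/ e <= a -> c <= e -> overlap a b c e = 0.
Proof.
move=> h ce; rewrite /overlap; apply/max_idPl; rewrite subr_le0.
case: h => h; rewrite ge_min !le_max ?h ?orbT //.
Qed.

(** The map [t -> c + t * D] sends [[0, 1)] onto [[c, c + D)] and multiplies lengths by [D]. The
    left side is the coordinate factor produced by the corners [subbox_lo] and [subbox_hi]. *)
Lemma overlap_translate (a b c D : R) : 0 < D ->
  Num.max 0 (Num.min (c + b * D) (c + D) - Num.max (c + a * D) c)
  = D * overlap a b 0 1.
Proof.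
move=> D0; rewrite /overlap maxr_pMr ?ltW // mulr0; congr (Num.max _ _).
rewrite mulrBr minr_pMr ?ltW // maxr_pMr ?ltW // mulr0 mulr1.
rewrite -{4}[c]addr0 -!addr_minr -!addr_maxr !(mulrC D).
by rewrite opprD addrACA subrr add0r.
Qed.

Definition cell_val (L : nat) (f : pt R d -> R) (k : {ffun 'I_d -> 'I_L}) : R :=
  f (fun i => (k i)%:R / L%:R).

(** Any other cell differs from [k] in some coordinate, where its overlap with the box is zero.
    Truncation at 0 keeps the formula valid for empty boxes. *)
Lemma pc_box_integral_in_cell (L : nat) (hL : (0 < L)%N) (f : pt R d -> R)
    (k : {ffun 'I_d -> 'I_L}) a b :
  (forall i, (k i)%:R / L%:R <= a i) -> (forall i, b i <= (k i).+1%:R / L%:R) ->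
  pc_box_integral L f a b = cell_val f k * \prod_(i < d) Num.max 0 (b i - a i).
Proof.
move=> ha hb; rewrite /pc_box_integral (bigD1 k) //= [X in _ + X]big1 ?addr0; last first.
  move=> k' /eqP neq; have [i ki] : exists i, k' i != k i.
    apply/existsP; apply: contra_notT neq; rewrite negb_exists => /forallP e.
    by apply/ffunP => i; have := e i; rewrite negbK => /eqP.
  rewrite (bigD1 i) //= overlap_eq0 ?mul0r ?mulr0 //; last first.
    by rewrite ler_pM2r ?invr_gt0 ?ltr0n // ler_nat.
  have : (k' i < k i)%N || (k i < k' i)%N by rewrite -neq_ltn.
  have L0 : (0 : R) < L%:R^-1 by rewrite invr_gt0 ltr0n.
  case/orP => lt; [right|left].
    by apply: le_trans (ha i); rewrite ler_pM2r // ler_nat.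
  by apply: le_trans (hb i) _; rewrite ler_pM2r // ler_nat.
congr (_ * _); apply: eq_bigr => i _; exact: overlap_sub.
Qed.

End BoxLaw.

(** * Chains in ordered boxes, and ranks of hits *)

Section Chains.
Context {R : realType} {d : nat}.
Implicit Types (a b x : pt R d).

Lemma sum_card_le_bigcup (T K : finType) (A : {pred K}) (S : K -> {set T}) :
  {in A &, forall k k' m, m \in S k -> m \in S k' -> k = k'} ->
  (\sum_(k in A) #|S k| <= #|(\bigcup_(k in A) S k)%SET|)%N.
Proof.
move=> dis; rewrite -[leqRHS]sum1_card [leqRHS]big_mkcond /=.
under eq_bigr do rewrite -sum1_card big_mkcond /=.
rewrite exchange_big /=; apply: leq_sum => m _.
have [/bigcupP [k kA mk]|h] := boolP (m \in (\bigcup_(k in A) S k)%SET).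
  rewrite (bigD1 k) //= mk big1 // => k' /andP[kA' kk'].
  by case: ifP => // mk'; rewrite (dis _ _ kA' kA m mk' mk) eqxx in kk'.
rewrite big1 // => k kA; case: ifP => // mk; case/bigcupP: h; by exists k.
Qed.

(** The predicate maximised over in [longest_chain], copied so that the two are convertible. *)
Definition is_chain n (x : 'I_n -> pt R d) (S : {set 'I_n}) : bool :=
  [forall i in S, forall j in S,
     (leqv (x i) (x j) || leqv (x j) (x i)) &&
     ([forall k, x i k == x j k] ==> (i == j))].

Lemma is_chainP n (x : 'I_n -> pt R d) (S : {set 'I_n}) :
  reflect (forall i j, i \in S -> j \in S ->
     (leqv (x i) (x j) || leqv (x j) (x i)) /\
     ((forall k, x i k = x j k) -> i = j)) (is_chain x S).
Proof.
apply: (iffP forall_inP) => [H i j iS jS|H i iS].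
  have /forall_inP/(_ j jS)/andP[h1 /implyP h2] := H i iS; split => // e.
  by apply/eqP/h2/forallP => k; apply/eqP.
apply/forall_inP => j jS; have [-> h] := H i j iS jS; apply/implyP => /forallP e.
by apply/eqP/h => k; apply/eqP.
Qed.

Definition box_chain a b (x : nat -> pt R d) n : nat :=
  \max_(S : {set 'I_n} | is_chain (fun m : 'I_n => x m) S &&
          [forall m in S, inbox a b (x m)]) #|S|.

(** Points of two half-open boxes ordered corner to corner are strictly ordered in every coordinate.
    Hence optimal chains chosen in the boxes are disjoint and their union is a chain; [0 < d]
    provides a coordinate that tells the points apart. *)
Lemma box_chain_sum (hd : (0 < d)%N) (K : finType) (A : {pred K})
    (a b : K -> pt R d) (x : nat -> pt R d) n :
  {in A &, forall k k', k != k' ->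
     (forall i, b k i <= a k' i) \/ (forall i, b k' i <= a k i)} ->
  (\sum_(k in A) box_chain (a k) (b k) x n
     <= longest_chain (fun m : 'I_n => x m))%N.
Proof.
move=> ord.
have exS k : exists S : {set 'I_n}, [/\ is_chain (fun m : 'I_n => x m) S,
    (forall m, m \in S -> inbox (a k) (b k) (x m)) &
    box_chain (a k) (b k) x n = #|S|].
  pose F := [pred S : {set 'I_n} | is_chain (fun m : 'I_n => x m) S &&
          [forall m in S, inbox (a k) (b k) (x m)]].
  have F0 : F finset.set0.
    apply/andP; split; first by apply/is_chainP => i j; rewrite inE.
    by apply/forall_inP => m; rewrite inE.
  have [S /andP[S1 /forall_inP S2] S3] : {S | F S &
      box_chain (a k) (b k) x n = #|S|}.
    by apply: (@eq_bigmax_cond _ F (fun S => #|S|)); apply/card_gt0P; exists finset.set0.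
  by exists S.
have [S /all_and3 [Sch Sin Scard]] := all_sig (fun k => cid (exS k)).
have lt k k' m m' : k \in A -> k' \in A -> k != k' -> m \in S k -> m' \in S k' ->
    (forall i, x m i < x m' i) \/ (forall i, x m' i < x m i).
  move=> kA kA' kk' /Sin/forallP h /Sin/forallP h'.
  case: (ord k k' kA kA' kk') => o; [left|right] => i.
    have /andP[_ u] := h i; have /andP[v _] := h' i.
    exact: lt_le_trans u (le_trans (o i) v).
  have /andP[u _] := h i; have /andP[_ v] := h' i.
  exact: lt_le_trans v (le_trans (o i) u).
pose i0 := Ordinal hd.
rewrite (eq_bigr (fun k => #|S k|)) => [|k _]; last exact: Scard.
apply: (@leq_trans #|(\bigcup_(k in A) S k)%SET|).
  apply: sum_card_le_bigcup => k k' kA kA' m mk mk'.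
  apply/eqP/negPn/negP => kk'.
  by case: (lt k k' m m kA kA' kk' mk mk') => /(_ i0); rewrite ltxx.
have leqvlt m m' : (forall i, x m i < x m' i) -> leqv (x m) (x m').
  by move=> h; apply/forallP => i; exact: ltW.
apply: (@leq_bigmax_cond _ (is_chain (fun m : 'I_n => x m)) (fun S => #|S|)).
apply/is_chainP => m m' /bigcupP[k kA mk] /bigcupP[k' kA' mk'].
have [kk'|kk'] := eqVneq k k'.
  by move/is_chainP: (Sch k); apply => //; rewrite kk'.
have [h|h] := lt k k' m m' kA kA' kk' mk mk'; split; rewrite ?(leqvlt _ _ h) ?orbT //.
  by move=> /(_ i0) e; have := h i0; rewrite e ltxx.
by move=> /(_ i0) e; have := h i0; rewrite e ltxx.
Qed.

(** When [h m] holds, [hits h m] is also the rank of [m] among the hits, counted from 0. *)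
Definition hits (h : nat -> bool) n : nat := \sum_(m < n) h m.

Lemma hitsS h n : hits h n.+1 = (hits h n + h n)%N.
Proof. by rewrite /hits big_ord_recr. Qed.

Lemma hits_mono h : {homo hits h : m n / (m <= n)%N}.
Proof. by apply: homo_leq => [//||n]; [exact: leq_trans|rewrite hitsS leq_addr]. Qed.

(** Together with [hits_inj], this makes the rank a bijection from the hits before [n] onto the
    numbers below [hits h n]. *)
Lemma hits_time h n j : (j < hits h n)%N ->
  exists m, [/\ (m < n)%N, h m & hits h m = j].
Proof.
elim: n => [|n IH]; first by rewrite /hits big_ord0.
have [/IH [m [mn hm <-]] _|jn] := ltnP j (hits h n).
  by exists m; split => //; exact: ltnW.
rewrite hitsS; case hn: (h n); rewrite ?addn1 ?addn0 => jlt; last first.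
  by move: (leq_trans jlt jn); rewrite ltnn.
by exists n; split => //; apply/eqP; rewrite eqn_leq jn -ltnS.
Qed.

Lemma hits_inj (h : nat -> bool) m m' : h m -> h m' -> hits h m = hits h m' -> m = m'.
Proof.
wlog lt : m m' / (m < m')%N => [W hm hm' e|hm hm' e].
  by case: (ltngtP m m') => // lt; [exact: W|apply/esym; exact: W].
by have := hits_mono h lt; rewrite hitsS hm -e addn1 ltnn.
Qed.

Definition rescale a b x : pt R d := fun i => (x i - a i) / (b i - a i).

(** [rescale] preserves and reflects the order, so the map [tau] from a rank to the index of the
    corresponding hit carries chains of [y] to chains in the box. *)
Lemma box_chain_rescale a b (x y : nat -> pt R d) n :
  (forall i, a i < b i) ->
  let h m := inbox a b (x m) in
  (forall m, h m -> y (hits h m) = rescale a b (x m)) ->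
  (longest_chain (fun j : 'I_(hits h n) => y j) <= box_chain a b x n)%N.
Proof.
move=> ab h yE.
have [tau0 H] := all_sig (fun j : 'I_(hits h n) => cid (hits_time (ltn_ord j))).
have {tau0 H} [tau H] : {tau : 'I_(hits h n) -> 'I_n |
    forall j, h (tau j) /\ hits h (tau j) = j}.
  have ltn j : (tau0 j < n)%N by have [] := H j.
  by exists (fun j => Ordinal (ltn j)) => j /=; have [] := H j.
have tau_inj : injective tau.
  by move=> j j' e; apply/val_inj; rewrite /= -(H j).2 -(H j').2 e.
have le_resc z z' : leqv (rescale a b z) (rescale a b z') = leqv z z'.
  apply: eq_forallb => i; rewrite /rescale ler_pM2r ?lerD2r //.
  by rewrite invr_gt0 subr_gt0.
apply/bigmax_leqP => S Sch; rewrite -(card_imset _ tau_inj).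
apply: (@leq_bigmax_cond _ (fun S : {set 'I_n} => is_chain (fun m : 'I_n => x m) S &&
          [forall m in S, inbox a b (x m)]) (fun S => #|S|)).
apply/andP; split; last first.
  by apply/forall_inP => m /imsetP [j _ ->]; have [] := H j.
move/is_chainP: (Sch : is_chain _ _) => {}Sch.
apply/is_chainP => m m' /imsetP [j jS ->] /imsetP [j' jS' ->].
have [] := Sch j j' jS jS'.
have yy (i : 'I_(hits h n)) : y i = rescale a b (x (tau i)) by rewrite -(yE _ (H i).1) (H i).2.
rewrite !yy !le_resc => c u; split => // e; congr tau; apply: u => k.
by rewrite /rescale e.
Qed.
End Chains.

(** * Law of the points falling in a box *)

Section HitProbability.
Context {R : realType} {d : nat} {dT : measure_display} {T : measurableType dT}.
Variables (P : probability T R) (X : nat -> T -> pt R d) (mu : pt R d -> pt R d -> R).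
Hypothesis hX : iid_boxlaw P X mu.

Definition box_event (a b : pt R d) m : set T := [set w | inbox a b (X m w)].

Lemma measurable_box_event a b m : measurable (box_event a b m).
Proof.
have -> : box_event a b m =
    \bigcap_(i in [set: 'I_d]) ((fun w => X m w i) @^-1` `[a i, b i[%classic).
  apply/seteqP; split => w /= h.
    by move=> i _ /=; rewrite in_itv /=; exact: (forallP h).
  by apply/forallP => i; have := h i I; rewrite /= in_itv.
apply: fin_bigcap_measurable => // i _; rewrite -[X in measurable X]setTI.
by apply: hX.1 => //; exact: measurable_itv.
Qed.

Definition future k n (lo hi : nat -> pt R d) : set T :=
  [set w | forall m, (k <= m < n)%N -> inbox (lo m) (hi m) (X m w)].

Lemma measurable_future k n lo hi : measurable (future k n lo hi).
Proof.
have -> : future k n lo hi =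
    \bigcap_(m in [set m | (k <= m < n)%N]) box_event (lo m) (hi m) m by [].
by apply: bigcap_measurableType => m _; exact: measurable_box_event.
Qed.

Lemma future_prob n lo hi :
  P (future 0 n lo hi) = (\prod_(0 <= m < n) mu (lo m) (hi m))%:E.
Proof.
rewrite big_mkord -(hX.2 n (fun m => lo m) (fun m => hi m)); congr (P _).
apply/seteqP; split => w /= h.
  by move=> m i; have /forallP := h m (ltn_ord m); apply.
by move=> m mn; apply/forallP => i; exact: (h (Ordinal mn) i).
Qed.


Hypothesis mu1 : mu (fun _ => 0) (fun _ => 1) = 1.
Let unit_event m : set T := box_event (fun _ => 0) (fun _ => 1) m.

(** By [mu1] each point lies almost surely in the unit cube. Adding this event turns the absence of
    a condition on [X m] into a box condition, the only kind whose probability [iid_boxlaw]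
    gives. *)
Lemma prob_setI_unit m (W : set T) : measurable W -> P (W `&` unit_event m) = P W.
Proof.
move=> mW; have mU := measurable_box_event (fun _ => 0) (fun _ => 1) m.
rewrite [RHS](measureDI P mW mU) -[LHS]add0e; congr (_ + _)%E; apply/esym.
apply: (@subset_measure0 _ _ _ P _ (~` unit_event m)) => //.
- exact: measurableD.
- exact: measurableC.
apply: (eq_trans (probability_setC P mU)).
suff -> : P (unit_event m) = 1%E by rewrite subee.
apply/eqP; rewrite eq_le probability_le1 //=.
(* [iid_boxlaw] speaks of initial segments only, so all points up to [m] are placed in the cube. *)
have <- : P (future 0 m.+1 (fun _ _ => 0) (fun _ _ => 1)) = 1%E.
  by rewrite future_prob big1.
apply: le_measure; rewrite ?inE //; first exact: measurable_future.
by move=> w; apply; rewrite leq0n ltnSn.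
Qed.

Variables (A B : pt R d) (Dlo Dhi : nat -> pt R d).
Let hit (w : T) (m : nat) : bool := inbox A B (X m w).
Hypothesis D_sub : forall j x, inbox (Dlo j) (Dhi j) x -> inbox A B x.

(** Exactly [c] hits, the one of rank [j] lying in the box of corners [Dlo j], [Dhi j]. Constant
    boxes [A], [B] give the law of the count; smaller ones give the joint law of the successive
    hits. *)
Definition hit_run k c : set T :=
  [set w | hits (hit w) k = c /\ forall m, (m < k)%N -> hit w m ->
      inbox (Dlo (hits (hit w) m)) (Dhi (hits (hit w) m)) (X m w)].

Lemma hit_run0 : hit_run 0 0 = setT.
Proof. by apply/seteqP; split => w //= _; split => //; rewrite /hits big_ord0. Qed.

Lemma hit_run0S c : hit_run 0 c.+1 = set0.
Proof. by apply/seteqP; split => w //= -[]; rewrite /hits big_ord0. Qed.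

Lemma hit_runS0 k : hit_run k.+1 0 = hit_run k 0 `\` box_event A B k.
Proof.
apply/seteqP; split => w; rewrite /hit_run /= => -[].
  rewrite hitsS => /eqP; rewrite addn_eq0 eqb0 => /andP[/eqP hk nk] H.
  by split; [split => // m mk|exact/negP]; apply: H; exact: ltnW.
move=> [hk H] /negP nk; rewrite hitsS hk /hit (negbTE nk); split => // m.
by rewrite ltnS leq_eqVlt => /predU1P[->|]; [rewrite (negbTE nk)|exact: H].
Qed.

Lemma hit_runSS k c : hit_run k.+1 c.+1 =
  (hit_run k c.+1 `\` box_event A B k) `|`
  (hit_run k c `&` box_event (Dlo c) (Dhi c) k).
Proof.
apply/seteqP; split => w; rewrite /hit_run /= hitsS.
  move=> [e H]; have H' m : (m < k)%N -> hit w m ->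
      inbox (Dlo (hits (hit w) m)) (Dhi (hits (hit w) m)) (X m w).
    by move=> mk; apply: H; exact: ltnW.
  case hk: (hit w k) e; rewrite ?addn1 ?addn0 => e; [right|left].
    case: e => e; split => //; have := H k (ltnSn k) hk; by rewrite e.
  by split => //; apply/negP; rewrite -/(hit w k) hk.
move=> [[[e H] /negP nk]|[[e H] Dk]].
  rewrite [hit w k](negbTE nk) addn0; split => // m.
  by rewrite ltnS leq_eqVlt => /predU1P[->|]; [rewrite /hit (negbTE nk)|exact: H].
rewrite [hit w k](D_sub Dk) e addn1; split => // m.
by rewrite ltnS leq_eqVlt => /predU1P[->|]; [rewrite e|exact: H].
Qed.

Lemma measurable_hit_run k c : measurable (hit_run k c).
Proof.
elim: k c => [|k IH] [|c]; rewrite ?hit_run0 ?hit_run0S ?hit_runS0 ?hit_runSS //.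
  by apply: measurableD => //; exact: measurable_box_event.
apply: measurableU; first by apply: measurableD => //; exact: measurable_box_event.
by apply: measurableI => //; exact: measurable_box_event.
Qed.

(** Overriding the box at [k] absorbs a condition on [X k] into the free boxes of the induction
    hypothesis. *)
Let upd (k : nat) (a : pt R d) (lo : nat -> pt R d) m := if m == k then a else lo m.

Let future_upd k n lo hi a b : (k < n)%N ->
  future k n (upd k a lo) (upd k b hi) = box_event a b k `&` future k.+1 n lo hi.
Proof.
move=> kn; apply/seteqP; split => w /=.
  move=> H; split; first by have := H k; rewrite /upd eqxx leqnn kn; apply.
  move=> m /andP[km mn]; have := H m; rewrite /upd mn ltnW // gtn_eqF //.
  exact.
move=> [H1 H2] m /andP[km mn]; rewrite /upd; case: eqVneq => [->//|nk].
by apply: H2; rewrite mn ltn_neqAle eq_sym nk km.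
Qed.

Let prod_upd k n lo hi a b : (k < n)%N ->
  \prod_(k <= m < n) mu (upd k a lo m) (upd k b hi m) =
  mu a b * \prod_(k.+1 <= m < n) mu (lo m) (hi m).
Proof.
move=> kn; rewrite big_ltn // {1 2}/upd eqxx; congr (_ * _).
by apply: eq_big_nat => m /andP[km _]; rewrite /upd gtn_eqF.
Qed.

(* Keeping free boxes on the coordinates after [k] makes the induction on [k] go through. *)
Lemma hit_run_future_prob k c n lo hi : (k <= n)%N ->
  P (hit_run k c `&` future k n lo hi) =
  ('C(k, c)%:R * \prod_(j < c) mu (Dlo j) (Dhi j) * (1 - mu A B) ^+ (k - c)
     * \prod_(k <= m < n) mu (lo m) (hi m))%:E.
Proof.
elim: k c lo hi => [|k IH] c lo hi kn.
  case: c => [|c]; last by rewrite hit_run0S set0I measure0 bin0n !mul0r.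
  by rewrite hit_run0 setTI future_prob bin0 big_ord0 expr0 !mul1r.
have box c' a b : P (hit_run k c' `&` box_event a b k `&` future k.+1 n lo hi) =
   ('C(k, c')%:R * \prod_(j < c') mu (Dlo j) (Dhi j) * (1 - mu A B) ^+ (k - c')
     * (mu a b * \prod_(k.+1 <= m < n) mu (lo m) (hi m)))%:E.
  by rewrite -setIA -future_upd // IH ?prod_upd // ltnW.
have mf := measurable_future k.+1 n lo hi.
have mr := measurable_hit_run k.
have mb := measurable_box_event.
(* Missing the box is not a box condition: its probability is that of the unit cube minus that of
   the box. *)
have miss c' : P ((hit_run k c' `\` box_event A B k) `&` future k.+1 n lo hi) =
   ('C(k, c')%:R * \prod_(j < c') mu (Dlo j) (Dhi j) * (1 - mu A B) ^+ (k - c')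
     * ((1 - mu A B) * \prod_(k.+1 <= m < n) mu (lo m) (hi m)))%:E.
  have mW : measurable (hit_run k c' `&` future k.+1 n lo hi) by exact: measurableI.
  rewrite setIDAC setIDA.
  have -> (U V : set T) : measurable U -> measurable V ->
      P (U `\` V) = (P U - P (U `&` V))%E.
    move=> mU mV; apply: measureD => //.
    by rewrite (le_lt_trans (probability_le1 P mU)) // ltry.
  all: rewrite ?mb //.
  rewrite -(prob_setI_unit k mW) !(setIAC _ (future _ _ _ _)) !box mu1 -EFinB.
  by congr EFin; ring.
case: c => [|c]; first by rewrite hit_runS0 miss !bin0 !subn0 exprSr; congr EFin; ring.
have addU (U V : set T) : measurable U -> measurable V -> U `&` V = set0 ->
    P (U `|` V) = (P U + P V)%E by exact: measureU.
rewrite hit_runSS setIUl addU; last 3 first.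
- by apply: measurableI => //; exact: measurableD.
- by apply: measurableI => //; exact: measurableI.
- rewrite -subset0 => w /= [[[_ nk] _] [[_ Dk] _]]; apply: nk; exact: D_sub Dk.
rewrite miss box -EFinD; congr EFin; rewrite binS natrD big_ord_recr /= subSS.
(* Pascal's rule. For [k <= c] the truncated exponent [k - c.+1] is wrong, but its binomial
   coefficient vanishes. *)
have [ck|kc] := ltnP c k; last by rewrite bin_small //; ring.
by rewrite -(subnSK ck) exprSr; ring.
Qed.

Lemma hit_run_prob k c :
  P (hit_run k c) =
  ('C(k, c)%:R * \prod_(j < c) mu (Dlo j) (Dhi j) * (1 - mu A B) ^+ (k - c))%:E.
Proof.
have := @hit_run_future_prob k c k (fun _ _ => 0) (fun _ _ => 1) (leqnn k).
rewrite big_geq // mulr1 => <-; congr (P _); rewrite -[LHS]setIT; congr (_ `&` _).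
by apply/seteqP; split => w //= _ m /andP[km /(leq_ltn_trans km)]; rewrite ltnn.
Qed.

End HitProbability.

(** * The number of hits, and the law of the rescaled hits *)

Section HitSequence.
Context {R : realType} {d : nat} {dT : measure_display} {T : measurableType dT}.
Variables (P : probability T R) (X : nat -> T -> pt R d) (mu : pt R d -> pt R d -> R).
Hypothesis hX : iid_boxlaw P X mu.
Hypothesis mu1 : mu (fun _ => 0) (fun _ => 1) = 1.
Variables (A B : pt R d).
Let p := mu A B.
Let hit (w : T) (m : nat) : bool := inbox A B (X m w).

Definition hits_event n c : set T := [set w | hits (hit w) n = c].

Lemma hits_eventE n c :
  hits_event n c = hit_run X A B (fun _ => A) (fun _ => B) n c.
Proof. by apply/seteqP; split => w; [move=> e; split|case]. Qed.

Lemma measurable_hits_event n c : measurable (hits_event n c).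
Proof. by rewrite hits_eventE; exact: (measurable_hit_run hX). Qed.

Lemma hits_event_prob n c :
  P (hits_event n c) = ('C(n, c)%:R * p ^+ c * (1 - p) ^+ (n - c))%:E.
Proof.
rewrite hits_eventE (hit_run_prob hX mu1) // prodr_const card_ord.
by [].
Qed.

Lemma hits_le (w : T) n : (hits (hit w) n <= n)%N.
Proof.
elim: n => [|n IH]; first by rewrite /hits big_ord0.
by rewrite hitsS -addn1 leq_add // leq_b1.
Qed.

(** [mu] is just a function of two corners; [p] is recognised as the probability that the first
    point hits. *)
Lemma mu_box_ge0 : 0 <= p.
Proof.
have : (0 <= P (hits_event 1 1))%E by exact: measure_ge0.
by rewrite hits_event_prob lee_fin expr1 subnn expr0 mulr1 mul1r.
Qed.

Lemma mu_box_le1 : p <= 1.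
Proof.
have := probability_le1 P (measurable_hits_event 1 1).
by rewrite hits_event_prob lee_fin expr1 subnn expr0 mulr1 mul1r.
Qed.

(** Total probability over the value of the count. The extra event [S] lets it serve for the joint
    law of the hits as well. *)
Lemma hits_split (Q : pred nat) (S : set T) n : measurable S ->
  measurable (S `&` [set w | Q (hits (hit w) n)]) /\
  P (S `&` [set w | Q (hits (hit w) n)]) =
  (\sum_(c < n.+1 | Q c) P (S `&` hits_event n c))%E.
Proof.
move=> mS.
have mF (c : 'I_n.+1) : Q c -> measurable (S `&` hits_event n c).
  by move=> _; apply: measurableI => //; exact: measurable_hits_event.
have -> : S `&` [set w | Q (hits (hit w) n)] =
    \big[setU/set0]_(c < n.+1 | Q c) (S `&` hits_event n c).
  apply/seteqP; split => w.
    move=> [Sw Qw]; have lt : (hits (hit w) n < n.+1)%N by rewrite ltnS hits_le.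
    by rewrite (bigD1 (Ordinal lt)) //=; left.
  elim/big_ind : _ => [//|U V HU HV [/HU|/HV]//|c Qc [Sw cE]].
  by split => //=; rewrite [hits _ _]cE.
split; first exact: bigsetU_measurable.
apply: measure_bigsetU_ord_cond => //.
by move=> c c' _ _ [w [[_ cE] [_ cE']]]; apply/val_inj; rewrite /= -cE -cE'.
Qed.

Definition few_hits (q : R) n : set T := [set w | (hits (hit w) n)%:R <= q * n%:R].

Lemma measurable_few_hits q n : measurable (few_hits q n).
Proof.
have [+ _] := hits_split [pred c | c%:R <= q * n%:R] n measurableT.
by rewrite setTI.
Qed.

(* Chernoff: weight each value [c] of the binomial count by [exp (s (q n - c))]. *)
Lemma few_hits_prob (q : R) : 0 < q < p ->
  exists2 r : R, 0 <= r < 1 & forall n, (P (few_hits q n) <= (r ^+ n)%:E)%E.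
Proof.
move=> /andP[q0 qp]; have p0 := lt_trans q0 qp; have p1 := mu_box_le1.
(* Makes [q * (1 + s)] the midpoint of [p] and [q]; being below [p], it gives
   [s * q < p * (1 - (1 + s)^-1)] and hence [r < 1]. *)
pose s := (p / q - 1) / 2.
have s0 : 0 < s by rewrite /s divr_gt0 // subr_gt0 ltr_pdivlMr // mul1r.
pose e := expR (- s); have e0 : 0 < e by exact: expR_gt0.
have e1 : e <= (1 + s)^-1.
  rewrite /e expRN lef_pV2 ?posrE ?expR_gt0 ?expR_ge1Dx //; lra.
pose r := expR (s * q) * (1 - p + p * e).
have r0 : 0 <= r by rewrite mulr_ge0 ?expR_ge0 // addr_ge0 ?subr_ge0 // mulr_ge0 ?ltW.
exists r.
  rewrite r0 /= /r; apply: (@le_lt_trans _ _ (expR (s * q) * expR (- (p * (1 - e))))).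
    rewrite ler_pM2l ?expR_gt0 //; apply: le_trans (expR_ge1Dx _).
    by lra.
  rewrite -expRD -[ltRHS]expR0 ltr_expR.
  have : p * (1 - (1 + s)^-1) <= p * (1 - e) by rewrite ler_pM2l // lerB.
  suff : s * q < p * (1 - (1 + s)^-1) by lra.
  have -> : p * (1 - (1 + s)^-1) = s * (p / (1 + s)) by field; lra.
  rewrite ltr_pM2l // ltr_pdivlMr; last lra.
  have -> : q * (1 + s) = (p + q) / 2 by rewrite /s; field; lra.
  lra.
move=> n; have [_ +] := hits_split [pred c | c%:R <= q * n%:R] n measurableT.
rewrite setTI /= => ->; under eq_bigr do rewrite setTI hits_event_prob.
rewrite sumEFin lee_fin big_mkcond /= /r exprMn -expRM_natl exprDn mulr_sumr.
apply: ler_sum => c _.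
have t0 : 0 <= 'C(n, c)%:R * p ^+ c * (1 - p) ^+ (n - c).
  by rewrite -lee_fin -hits_event_prob.
have -> : expR (n%:R * (s * q)) * ((1 - p) ^+ (n - c) * (p * e) ^+ c *+ 'C(n, c)) =
  expR (s * (q * n%:R - c%:R)) * ('C(n, c)%:R * p ^+ c * (1 - p) ^+ (n - c)).
  rewrite /e exprMn -expRM_natl -[X in _ * X = _]mulr_natr.
  rewrite [X in _ = expR X * _](_ : _ = n%:R * (s * q) + c%:R * - s); last by ring.
  by rewrite expRD; ring.
case: ifP => cq; last by rewrite mulr_ge0 ?expR_ge0.
rewrite ler_peMl //; apply: le_trans (expR_ge1Dx _).
by rewrite lerDl mulr_ge0 ?subr_ge0 // ltW.
Qed.

(** Borel-Cantelli: the probabilities of [few_hits q n] are dominated by a convergent geometric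
    series. *)
Lemma ae_many_hits (q : R) : 0 < q < p ->
  {ae P, forall w, \forall n \near \oo, q * n%:R < (hits (hit w) n)%:R}.
Proof.
move=> qp; have [r /andP[r0 r1] Hr] := few_hits_prob qp.
have mF n : measurable (few_hits q n) := measurable_few_hits q n.
have S : (\sum_(n <oo) P (few_hits q n) < +oo)%E.
  apply: (@le_lt_trans _ _ (1 - r)^-1%:E); last exact: ltry.
  apply: lime_le; first by apply: is_cvg_nneseries => n _ _; exact: measure_ge0.
  apply: nearW => n; apply: (@le_trans _ _ (\sum_(0 <= i < n) (r ^+ i)%:E)%E).
    by apply: lee_sum => i _; exact: Hr.
  rewrite sumEFin lee_fin.
  have -> : \sum_(0 <= i < n) r ^+ i = series (geometric 1 r) n.
    by rewrite /series /=; apply: eq_bigr => i _; rewrite mul1r.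
  rewrite geometric_seriesE ?lt_eqF //= mul1r ler_pdivrMr ?subr_gt0 //.
  rewrite mulVf ?lerBlDr ?lerDl ?exprn_ge0 //; lra.
exists (lim_sup_set (few_hits q)); split.
- by apply: bigcap_measurableType => n _; exact: bigcup_measurable.
- exact: lim_sup_set_cvg0.
move=> w /= nw n _; apply: contrapT => H; apply: nw.
exists n => // m /= nm; rewrite ltNge; apply/negP => few.
by apply: H; exists m.
Qed.

(** Eventually [r <= p / 2 * n], so having fewer than [r] hits is covered by the Chernoff bound.
    This justifies conditioning on at least [r] hits in [hit_seq_iid]. *)
Lemma many_hits_prob_cvg r : 0 < p ->
  exists2 u : R^nat, u @ \oo --> (0 : R) &
    \forall n \near \oo, (P (~` [set w | (r <= hits (hit w) n)%N]) <= (u n)%:E)%E.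
Proof.
move=> p0; have [|rho /andP[rho0 rho1] Hr] := @few_hits_prob (p / 2); first lra.
exists (fun n => rho ^+ n); first by apply: cvg_expr; rewrite ger0_norm.
have [N HN] : exists N : nat, r%:R <= p / 2 * N%:R.
  exists (Num.bound (r%:R / (p / 2))); rewrite mulrC -ler_pdivrMr; last lra.
  by apply/ltW/archi_boundP; rewrite divr_ge0 //; lra.
exists N => // n /= Nn; apply: le_trans (Hr n).
have [+ _] := hits_split [pred c | (r <= c)%N] n measurableT.
rewrite setTI => mS; apply: le_measure; rewrite ?inE.
- exact: measurableC.
- exact: measurable_few_hits.
move=> w /= /negP; rewrite -ltnNge => lt; rewrite /few_hits /=.
apply: (@le_trans _ _ r%:R); first by rewrite ler_nat ltnW.
by apply: le_trans HN _; rewrite ler_pM2l ?ler_nat //; lra.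
Qed.

(** With [subbox_hi], the part of the box that [rescale] sends into the box of corners [a], [b],
    clipped because the latter may leave the unit cube. *)
Definition subbox_lo (a : pt R d) : pt R d := fun i => Num.max (A i + a i * (B i - A i)) (A i).
Definition subbox_hi (b : pt R d) : pt R d :=
  fun i => Num.min (A i + b i * (B i - A i)) (A i + (B i - A i)).
Hypothesis AB : forall i, A i < B i.

Lemma inbox_subbox a b x : inbox (subbox_lo a) (subbox_hi b) x =
  inbox A B x && inbox a b (rescale A B x).
Proof.
apply/forallP/andP => [H|[/forallP H1 /forallP H2] i].
  split; apply/forallP => i; have := H i; rewrite /subbox_lo /subbox_hi ge_max lt_min;
    have D := AB i; rewrite -subr_gt0 in D => /andP[/andP[h1 h2] /andP[h3 h4]].
    by rewrite h2 /=; lra.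
  by rewrite /rescale ler_pdivlMr // ltr_pdivrMr // lerBrDl ltrBlDl h1 h3.
have := H1 i; have := H2 i; have D := AB i; rewrite -subr_gt0 in D.
rewrite /rescale ler_pdivlMr // ltr_pdivrMr // lerBrDl ltrBlDl.
by rewrite /subbox_lo /subbox_hi ge_max lt_min => /andP[-> ->] /andP[-> h] /=; lra.
Qed.

(* [hit_seq j w] is the rescaled position of the [j]-th point falling in the box
   (0 when there is none); the limit is of an eventually constant sequence. *)
Definition hit_seq (j : nat) (w : T) : pt R d := fun i =>
  lim ((\sum_(m < n) (hit w m && (hits (hit w) m == j))%:R * rescale A B (X m w) i)
    @[n --> \oo]).

(** By [hits_inj] at most one summand can be nonzero, whence eventually constant partial sums, also
    when there is no hit of rank [j]. *)
Lemma hit_seq_cvg j w i :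
  (\sum_(m < n) (hit w m && (hits (hit w) m == j))%:R * rescale A B (X m w) i)
    @[n --> \oo] --> hit_seq j w i /\
  (forall m, hit w m -> hits (hit w) m = j -> hit_seq j w i = rescale A B (X m w) i).
Proof.
set u := (fun n => _); have [[m [hm mj]]|no] :=
    pselect (exists m, hit w m /\ hits (hit w) m = j).
  have C : u @ \oo --> rescale A B (X m w) i.
    apply: cvg_near_cst; exists m.+1 => // n /= mn; rewrite /u.
    rewrite (bigD1 (Ordinal mn)) //= hm mj eqxx mul1r big1 ?addr0 // => m' /eqP ne.
    case hm': (hit w m'); last by rewrite mul0r.
    case: eqP => [e|_]; rewrite ?mul0r //=; case: ne; apply/val_inj => /=.
    by apply: (hits_inj hm' hm); rewrite e mj.
  have e : hit_seq j w i = rescale A B (X m w) i by apply: cvg_lim C.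
  split; first by rewrite e.
  by move=> m' hm' mj'; rewrite (hits_inj hm' hm) // mj mj'.
have C : u @ \oo --> (0 : R).
  apply: cvg_near_cst; apply: nearW => n; rewrite /u big1 // => m _.
  case: (boolP (_ && _)) => [/andP[hm /eqP mj]|_]; rewrite ?mul0r //.
  by case: no; exists m.
have e : hit_seq j w i = 0 by apply: cvg_lim C.
by split; [rewrite e|move=> m hm mj; case: no; exists m].
Qed.

Lemma hit_seqE w m : hit w m -> hit_seq (hits (hit w) m) w = rescale A B (X m w).
Proof. by move=> hm; apply/funext => i; apply: (hit_seq_cvg _ w i).2. Qed.

Lemma measurable_hit_seq j i : measurable_fun setT (fun w => hit_seq j w i).
Proof.
apply: (@measurable_fun_cvg _ _ _ _ (fun n w => \sum_(m < n)
  (hit w m && (hits (hit w) m == j))%:R * rescale A B (X m w) i)); last first.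
  by move=> w _; exact: (hit_seq_cvg _ w i).1.
move=> n; apply: measurable_sum => m; apply: measurable_funM.
  have -> : (fun w => (hit w m && (hits (hit w) m == j))%:R : R) =
      \1_(box_event X A B m `&` hits_event m j).
    apply/funext => w; rewrite indicE; congr (_%:R); congr nat_of_bool.
    apply/idP/idP; first by move=> /andP[h /eqP e]; rewrite inE; split.
    by rewrite inE => -[h e]; apply/andP; split => //; apply/eqP.
  apply: measurable_indic; apply: measurableI; last exact: measurable_hits_event.
  exact: measurable_box_event hX _ _ _.
rewrite /rescale; apply: measurable_funM => //.
by apply: measurable_funB => //; exact: hX.1.
Qed.

Hypothesis p_gt0 : 0 < p.
Hypothesis mu_subbox : forall a b, mu (subbox_lo a) (subbox_hi b) = p * unif_box a b.

(** When there are exactly [c >= r] hits, the event [G] is a [hit_run] with [r] sub-boxes and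
    [c - r] full boxes, so its probability is [U] times that of the count. Summing over [c] and
    letting [n] grow gives [P G = U]. *)
Lemma hit_seq_iid : iid_boxlaw P hit_seq (@unif_box R d).
Proof.
split; first exact: measurable_hit_seq.
move=> r a b.
(* Hits of rank [r] or more are constrained to the whole box only. *)
pose lo j : pt R d := if insub j is Some j then subbox_lo (a j) else A.
pose hi j : pt R d := if insub j is Some j then subbox_hi (b j) else B.
pose G : set T := [set w | forall (m : 'I_r) i, a m i <= hit_seq m w i < b m i].
have mG : measurable G.
  have -> : G = \bigcap_(m in [set: 'I_r]) \bigcap_(i in [set: 'I_d])
      ((fun w => hit_seq m w i) @^-1` `[a m i, b m i[%classic).
    apply/seteqP; split => w /= h.
      by move=> m _ i _ /=; rewrite in_itv; exact: h.
    by move=> m i; have := h m I i I; rewrite /= in_itv.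
  apply: fin_bigcap_measurable => // m _; apply: fin_bigcap_measurable => // i _.
  by rewrite -[X in measurable X]setTI; apply: measurable_hit_seq.
rewrite -/G; set U := \prod_(m < r) _.
have sub j x : inbox (lo j) (hi j) x -> inbox A B x.
  by rewrite /lo /hi; case: insubP => // m _ _; rewrite inbox_subbox => /andP[].
have GE n c : (r <= c)%N -> G `&` hits_event n c = hit_run X A B lo hi n c.
  move=> rc; apply/seteqP; split => w.
    move=> [Gw cE]; split => // m mn hm; rewrite /lo /hi; case: insubP => // j _ jE.
    rewrite inbox_subbox; apply/andP; split => //; apply/forallP => i.
    by have := Gw j i; rewrite jE hit_seqE.
  move=> [cE Hw]; split => // j i.
  have [m [mn hm mj]] : exists m, [/\ (m < n)%N, hit w m & hits (hit w) m = j].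
    by apply: hits_time; rewrite [hits _ _]cE; exact: leq_trans rc.
  have := Hw m mn hm; rewrite /hit in mj; rewrite mj /lo /hi valK inbox_subbox.
  by move=> /andP[_ /forallP/(_ i)]; rewrite -/(hit w) -hit_seqE // mj.
have prodE c : (r <= c)%N -> \prod_(j < c) mu (lo j) (hi j) = p ^+ c * U.
  move=> rc; rewrite -(subnKC rc) big_split_ord /=; under eq_bigr => j _.
    rewrite /lo /hi valK mu_subbox; over.
  rewrite big_split /= prodr_const card_ord; under [X in _ * X]eq_bigr => j _.
    rewrite /lo /hi insubF; last by rewrite /= ltnNge leq_addr.
    over.
  by rewrite prodr_const card_ord exprD -/U -/p; ring.
pose sigma n := \sum_(c < n.+1 | (r <= c)%N) ('C(n, c)%:R * p ^+ c * (1 - p) ^+ (n - c)).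
pose H n : set T := [set w | (r <= hits (hit w) n)%N].
have PH n : P (H n) = (sigma n)%:E.
  have [_ +] := hits_split [pred c | (r <= c)%N] n measurableT.
  rewrite setTI => ->; under eq_bigr do rewrite setTI hits_event_prob.
  by rewrite sumEFin.
have mH n : measurable (H n).
  by have [+ _] := hits_split [pred c | (r <= c)%N] n measurableT; rewrite setTI.
have PG n : P (G `&` H n) = (U * sigma n)%:E.
  have [_ ->] := hits_split [pred c | (r <= c)%N] n mG.
  rewrite /sigma mulr_sumr -sumEFin; apply: eq_bigr => c rc.
  by rewrite GE // (hit_run_prob hX mu1) // prodE //; congr EFin; rewrite -/p; ring.
have [u u0 [N _ Hu]] := many_hits_prob_cvg r p_gt0.
have PGfin : P G \is a fin_num by exact: fin_num_measure.
rewrite -(fineK PGfin); congr EFin; apply/eqP; rewrite -subr_eq0 -normr_eq0.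
set g := fine (P G); apply/negPn/negP => neq.
have gU : 0 < `|g - U| by rewrite lt_neqAle eq_sym neq normr_ge0.
have U1 : 0 < `|U| + 1 by have := normr_ge0 U; lra.
(* Splitting [G] along [H n] gives [|g - U| <= (|U| + 1) * (1 - sigma n)]; [n] is taken so large
   that this is violated. *)
have [M _ HM] : \forall n \near \oo, `|u n| < `|g - U| / (`|U| + 1).
  by apply: cvgr0_norm_lt => //; rewrite divr_gt0.
pose n := maxn N M.
have := HM n (leq_maxr _ _); have := Hu n (leq_maxl _ _) => /=.
have -> : P (~` H n) = (1 - P (H n))%E by exact: probability_setC.
rewrite PH -EFinB lee_fin ltr_pdivlMr // => su un.
have s1 : sigma n <= 1 by rewrite -lee_fin -PH; exact: probability_le1.
have gE : P G = (P (G `\` H n) + P (G `&` H n))%E by exact: measureDI.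
have rho_fin : P (G `\` H n) \is a fin_num by apply: fin_num_measure; exact: measurableD.
have rho0 : (0 <= P (G `\` H n))%E by exact: measure_ge0.
have rho1 : (P (G `\` H n) <= P (~` H n))%E.
  by apply: le_measure; rewrite ?inE; [exact: measurableD|exact: measurableC|move=> w []].
have : P (~` H n) = (1 - P (H n))%E by exact: probability_setC.
rewrite PH -EFinB => cE; rewrite cE in rho1.
move: gE rho0 rho1; rewrite PG -(fineK rho_fin) -(fineK PGfin) -EFinD !lee_fin -/g.
move=> [gE] rho0 rho1;
have : `|g - U| <= (`|U| + 1) * (1 - sigma n).
  have -> : g - U = - (U * (1 - sigma n)) + fine (P (G `\` H n)) by rewrite gE; ring.
  apply: le_trans (ler_normD _ _) _; rewrite normrN normrM (ger0_norm rho0).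
  by rewrite [`|1 - _|]ger0_norm ?subr_ge0 // mulrDl mul1r lerD2l.
apply/negP; rewrite -ltNge; apply: le_lt_trans un; rewrite mulrC ler_pM2r //.
exact: le_trans su (ler_norm _).
Qed.

End HitSequence.

(** * Chains inside one box *)

Section BoxLiminf.
Context {R : realType} {d : nat}.

Lemma root_powR (x : R) : (0 < d)%N -> 0 <= x -> (x ^+ d) `^ d%:R^-1 = x.
Proof.
move=> d0 x0; rewrite -powR_mulrn // -powRrM divff ?pnatr_eq0 -?lt0n //.
exact: powRr1.
Qed.

(** Inside one cell the density is constant, so mass is proportional to volume; this is what makes
    the rescaled hits uniform. *)
Lemma pc_subbox (L : nat) (hL : (0 < L)%N) (f : pt R d -> R)
    (k : {ffun 'I_d -> 'I_L}) (A B : pt R d) :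
  (forall i, (k i)%:R / L%:R <= A i) -> (forall i, B i <= (k i).+1%:R / L%:R) ->
  (forall i, A i < B i) -> forall a b,
  pc_box_integral L f (subbox_lo A B a) (subbox_hi A B b) =
  pc_box_integral L f A B * unif_box a b.
Proof.
move=> kA kB AB a b; rewrite !(@pc_box_integral_in_cell R d L hL f k) //; last 2 first.
- by move=> i; rewrite /subbox_lo le_max kA orbT.
- by move=> i; rewrite /subbox_hi ge_min; apply/orP; right; have := kB i; lra.
rewrite -mulrA; congr (_ * _); rewrite /unif_box -big_split /=.
apply: eq_bigr => i _; rewrite /subbox_lo /subbox_hi overlap_translate ?subr_gt0 //.
by rewrite (max_idPr _) // subr_ge0 ltW.
Qed.

Context {dT : measure_display} {T : measurableType dT}.
Variables (P : probability T R) (X : nat -> T -> pt R d) (mu : pt R d -> pt R d -> R).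
Hypothesis hX : iid_boxlaw P X mu.
Hypothesis mu1 : mu (fun _ => 0) (fun _ => 1) = 1.
Variables (A B : pt R d).
Hypothesis AB : forall i, A i < B i.
Hypothesis mu_gt0 : 0 < mu A B.
Variable cd : R.
Hypothesis hcd :
  {ae P, forall w, scaled_chain (fun m => hit_seq X A B m w) @ \oo --> cd}.
Hypothesis hd : (0 < d)%N.
Let p := mu A B.
Let hit (w : T) (m : nat) : bool := inbox A B (X m w).

(** An event of full probability is nonempty, and at one of its points [cd] is a limit of
    nonnegative numbers. *)
Lemma scaled_chain_cvg_ge0 : 0 <= cd.
Proof.
have ae_pf : ProperFilter (almost_everywhere P).
  apply: ae_properfilter_algebraOfSetsType.
  by move: (@lte01 R); rewrite -(probability_setT P).
have [w h] := filter_ex hcd.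
have <- : lim (scaled_chain (fun m => hit_seq X A B m w) @ \oo) = cd by exact: cvg_lim h.
by apply: limr_ge; [exact: cvgP h|apply: nearW => n; rewrite mulr_ge0 ?powR_ge0].
Qed.

(** With [N >= q * n] hits, the box holds a chain as long as the longest one among [N] uniform
    points, about [cd * N^(1/d)]. Only countably many [q] are used, so one null set serves every
    [eta]. *)
Lemma box_chain_liminf : {ae P, forall w (eta : R), eta < cd * p `^ d%:R^-1 ->
  \forall n \near \oo,
    eta <= n%:R `^ (- d%:R^-1) * (box_chain A B (X ^~ w) n)%:R}.
Proof.
(* The values [s j] lie in [[1/2, 1)] and tend to 1. Taking [q = p * s j ^+ d] makes its [d]-th root
   exactly [s j] times that of [p]. *)
pose s j : R := 1 - (j%:R + 2)^-1.
have s01 j : 0 < s j < 1.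
  have j0 := ler0n R j.
  have j2 : (0 : R) < (j%:R + 2)^-1 by rewrite invr_gt0; lra.
  rewrite /s subr_gt0 ltrBlDr ltrDl j2 andbT invf_lt1; lra.
have q0p j : 0 < p * s j ^+ d < p.
  have /andP[s0 s1] := s01 j.
  by rewrite mulr_gt0 ?exprn_gt0 //= gtr_pMr // exprn_ilt1 -?lt0n // ltW.
have many := ae_foralln (fun j => ae_many_hits hX mu1 (q0p j)).
apply: filterS2 hcd many => w cvg many eta etac.
have c0 : 0 < p `^ d%:R^-1 by exact: powR_gt0.
have [eta0|eta0] := leP eta 0.
  by apply: nearW => n; rewrite (le_trans eta0) // mulr_ge0 ?powR_ge0.
have [v0 /andP[ev0 v0cd]] : exists v0, eta / p `^ d%:R^-1 < v0 < cd.
  exists ((eta / p `^ d%:R^-1 + cd) / 2); have : eta / p `^ d%:R^-1 < cd.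
    by rewrite ltr_pdivrMr.
  lra.
have v00 : 0 < v0 by apply: lt_trans ev0; rewrite divr_gt0.
(* The two losses are now fixed: [v0] below [cd] for the uniform chains, [s j] below 1 for the
   count, with [eta] still below [v0 * s j * p^(1/d)]. *)
have [j sj] : exists j, eta / p `^ d%:R^-1 / v0 < s j.
  set x := _ / v0; have x1 : x < 1 by rewrite /x ltr_pdivrMr // mul1r.
  exists (Num.bound (1 - x)^-1).
  have := archi_boundP (ltW (_ : 0 < (1 - x)^-1)); rewrite invr_gt0 subr_gt0 => /(_ x1).
  set b := _%:R; move=> xb; rewrite /s ltrBrDl -ltrBrDr -[ltRHS]invrK.
  have b0 : 0 <= b := ler0n R _.
  by rewrite -/b ltf_pV2 ?posrE ?invr_gt0; lra.
have [M _ HM] : \forall N \near \oo, v0 <= scaled_chain (fun m => hit_seq X A B m w) N.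
  by near=> N; apply: ltW; near: N; apply: (cvgr_gt cd cvg).
have /andP[q0 qp] := q0p j; set q := p * _ in q0 qp.
have [K _ HK] := many j.
(* From [n >= M'] on, [q * n >= M], so there are at least [M] hits; the successor below keeps [n]
   positive. *)
pose M' := Num.bound (M%:R / q).
exists (maxn K M'.+1) => // n /=; rewrite geq_max => /andP[Kn Mn].
have n0 : (0 : R) < n%:R by rewrite ltr0n; exact: leq_ltn_trans Mn.
have qN : q * n%:R < (hits (hit w) n)%:R := HK n Kn.
have MN : (M <= hits (hit w) n)%N.
  rewrite -(ler_nat R); apply: le_trans (ltW qN); rewrite mulrC -ler_pdivrMr //.
  have Mq0 : 0 <= M%:R / q by rewrite divr_ge0 // ltW.
  by apply: le_trans (ltW (archi_boundP Mq0)) _; rewrite ler_nat ltnW.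
have := HM _ MN; rewrite /= /scaled_chain.
set N := hits _ _ in qN MN *; set l := longest_chain _ => vl.
have N0 : (0 : R) < N%:R by apply: lt_trans qN; rewrite mulr_gt0.
have lB : (l <= box_chain A B (X ^~ w) n)%N.
  apply: (@box_chain_rescale R d A B (X ^~ w) (fun m => hit_seq X A B m w) n AB).
  by move=> m hm; exact: hit_seqE.
apply: (@le_trans _ _ (n%:R `^ (- d%:R^-1) * l%:R)); last first.
  by rewrite ler_wpM2l ?powR_ge0 // ler_nat.
rewrite powRN mulrC ler_pdivlMr ?powR_gt0 //.
move: vl; rewrite powRN mulrC ler_pdivlMr ?powR_gt0 // => vl.
apply: le_trans vl.
apply: (@le_trans _ _ (v0 * (q * n%:R) `^ d%:R^-1)); last first.
  rewrite ler_wpM2l ?(ltW v00) // ge0_ler_powR ?invr_ge0 ?nnegrE ?(ltW qN) //.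
  by rewrite mulr_ge0 ?ltW.
rewrite powRM ?(ltW q0) // mulrA ler_pM2r ?powR_gt0 //.
have /andP[s0 _] := s01 j.
rewrite /q powRM ?(ltW mu_gt0) ?exprn_ge0 ?(ltW s0) // root_powR ?(ltW s0) //.
by move: sj; rewrite !ltr_pdivrMr // => /ltW; rewrite -/p; lra.
Unshelve. all: by end_near.
Qed.

End BoxLiminf.

(** * Integral of the speed along a curve *)

Section Curves.
Context {R : realType} {d : nat}.
Hypothesis hd : (0 < d)%N.
Variable g : 'I_d -> R -> R.
Hypothesis adm : admissible g.
Let mu := @lebesgue_measure R.

Lemma admissible_mono j (s t : R) : 0 <= s -> s <= t -> t <= 1 -> g j s <= g j t.
Proof.
have [der [_ [nn _]]] := adm.
move=> s0 st t1; apply: (@ger0_derive1_ndecr R (g j) 0 1) => //.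
- by move=> x /subset_itv_oo_cc; exact: der.
- by move=> x /subset_itv_oo_cc; exact: nn.
- by apply: derivable_within_continuous => x; exact: der.
Qed.

Lemma admissible_continuous j (t : R) : 0 <= t <= 1 -> g j x @[x --> t] --> g j t.
Proof.
move=> t01; apply: differentiable_continuous; apply/derivable1_diffP.
by apply: adm.1; rewrite in_itv.
Qed.

(** The geometric mean of the derivatives: the factor of [Jintegrand] that does not involve the
    density. *)
Definition speed (t : R) : R := (\prod_(j < d) derive1 (g j) t) `^ d%:R^-1.

Lemma measurable_derive1 j : measurable_fun (`[0, 1]%classic : set R) (derive1 (g j)).
Proof. by apply: subspace_continuous_measurable_fun; [|exact: adm.2.1]. Qed.

Lemma measurable_speed : measurable_fun (`[0, 1]%classic : set R) speed.
Proof.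
apply: (measurableT_comp (measurable_powR d%:R^-1)).
by apply: measurable_prod => j _; exact: measurable_derive1.
Qed.

Lemma subset_itv01 (a b : R) : 0 <= a -> b <= 1 -> `[a, b]%classic `<=` `[0, 1]%classic.
Proof.
move=> a0 b1 x /=; rewrite !in_itv /= => /andP[ax xb].
by rewrite (le_trans a0 ax) (le_trans xb b1).
Qed.

Lemma integral_derive1 j (a b : R) : 0 <= a -> a < b -> b <= 1 ->
  (\int[mu]_(t in `[a, b]) (derive1 (g j) t)%:E = (g j b - g j a)%:E)%E.
Proof.
move=> a0 ab b1; have sub := subset_itv01 a0 b1.
rewrite (@continuous_FTC2 _ _ (g j)) ?EFinB //.
- by apply: continuous_subspaceW sub _; exact: adm.2.1.
- split.
  + by move=> x /subset_itv_oo_cc /sub; exact: adm.1.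
  + by apply: cvg_at_right_filter; apply: admissible_continuous; lra.
  + by apply: cvg_at_left_filter; apply: admissible_continuous; lra.
Qed.

(* AM-GM applied to the ratios [g_j' / delta_j]. *)
Lemma speed_le (delta : 'I_d -> R) (t : R) : t \in `[0, 1] -> (forall j, 0 < delta j) ->
  speed t <= \sum_(j < d)
    (\prod_(i < d) delta i) `^ d%:R^-1 / d%:R / delta j * derive1 (g j) t.
Proof.
move=> t01 dl.
have g0 j : 0 <= derive1 (g j) t by exact: adm.2.2.1.
set D := \prod_(i < d) delta i.
have D0 : 0 < D by apply: prodr_gt0 => i _.
pose E j := derive1 (g j) t / delta j.
have E0 j : 0 <= E j by rewrite divr_ge0 // ltW.
have [+ _] := @leif_AGM R 'I_d xpredT E (fun j _ => E0 j).
rewrite card_ord; set m := _ / d%:R => AGM.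
have m0 : 0 <= m by rewrite divr_ge0 // sumr_ge0.
have -> : speed t = (D * \prod_(j < d) E j) `^ d%:R^-1.
  rewrite /speed -big_split /=; congr (_ `^ _); apply: eq_bigr => j _.
  by rewrite mulrC divfK // gt_eqF.
have -> : \sum_(j < d) D `^ d%:R^-1 / d%:R / delta j * derive1 (g j) t =
    (D * m ^+ d) `^ d%:R^-1.
  rewrite powRM ?exprn_ge0 ?(ltW D0) // root_powR // /m mulrA mulrAC -mulrA !mulr_sumr.
  by apply: eq_bigr => j _; rewrite /E; ring.
apply: ge0_ler_powR; rewrite ?nnegrE ?invr_ge0 //.
- by rewrite mulr_ge0 ?(ltW D0) // prodr_ge0.
- by rewrite mulr_ge0 ?(ltW D0) // exprn_ge0.
- by rewrite ler_pM2l.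
Qed.

(** Integrating the linear bound of [speed_le] leaves [d] terms, each at most [D^(1/d) / d].
    Allowing [delta] to exceed the increments keeps it positive even when an increment vanishes. *)
Lemma integral_speed_le_prod (delta : 'I_d -> R) (a b : R) :
  0 <= a -> a < b -> b <= 1 ->
  (forall j, 0 < delta j) -> (forall j, g j b - g j a <= delta j) ->
  (\int[mu]_(t in `[a, b]) (speed t)%:E <= ((\prod_j delta j) `^ d%:R^-1)%:E)%E.
Proof.
move=> a0 ab b1 dl gd; have sub := subset_itv01 a0 b1.
have mS (h : R -> R) : measurable_fun (`[0, 1]%classic : set R) h ->
    measurable_fun (`[a, b]%classic : set R) (fun t => (h t)%:E).
  move=> mh; apply/measurable_EFinP; apply: measurable_funS sub mh.
  exact: measurable_itv.
set D := \prod_j delta j.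
pose k j := D `^ d%:R^-1 / d%:R / delta j.
have k0 j : 0 <= k j by rewrite !divr_ge0 ?powR_ge0 // ltW.
have dg0 j t : `[a, b]%classic t -> 0 <= derive1 (g j) t.
  by move=> /sub; exact: adm.2.2.1.
apply: (@le_trans _ _ (\int[mu]_(t in `[a, b]) \sum_(j < d) ((k j)%:E * (derive1 (g j) t)%:E))%E).
  apply: ge0_le_integral => //.
  - by move=> t _; rewrite lee_fin powR_ge0.
  - apply: mS; exact: measurable_speed.
  - apply: emeasurable_sum => j; apply: measurable_funeM.
    apply: mS; exact: measurable_derive1.
  - by move=> t /sub tI; rewrite sumEFin lee_fin; exact: speed_le.
rewrite ge0_integral_sum //; last 2 first.
- by move=> j; apply: measurable_funeM; apply: mS; exact: measurable_derive1.
- by move=> j t tI; rewrite mule_ge0 // lee_fin ?dg0.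
rewrite (eq_bigr (fun j => (k j * (g j b - g j a))%:E)); last first.
  move=> j _; rewrite ge0_integralZl_EFin ?integral_derive1 //.
  - by move=> t tI; rewrite lee_fin dg0.
  - apply: mS; exact: measurable_derive1.
rewrite sumEFin lee_fin.
apply: (@le_trans _ _ (\sum_(j < d) D `^ d%:R^-1 / d%:R)).
  apply: ler_sum => j _; rewrite /k -mulrA ler_piMr ?divr_ge0 ?powR_ge0 //.
  by rewrite mulrC ler_pdivrMr // mul1r.
by rewrite sumr_const card_ord -[leLHS]mulr_natr divfK // pnatr_eq0 -lt0n.
Qed.

(** If some increment is zero, the previous bound is applied with positive [delta] whose product is
    arbitrarily small. *)
Lemma integral_speed_le (a b : R) : 0 <= a -> a <= b -> b <= 1 ->
  (\int[mu]_(t in `[a, b]) (speed t)%:E <= ((\prod_j (g j b - g j a)) `^ d%:R^-1)%:E)%E.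
Proof.
move=> a0; rewrite le_eqVlt => /predU1P[-> _|ab b1].
  by rewrite set_itv1 integral_set1 lee_fin powR_ge0.
have D0 j : 0 <= g j b - g j a by rewrite subr_ge0 admissible_mono // ltW.
have [/forallP pos|] := boolP [forall j, 0 < g j b - g j a].
  exact: integral_speed_le_prod.
rewrite negb_forall => /existsP[j0]; rewrite -leNgt => j00.
have Dj0 : g j0 b - g j0 a = 0 by apply/eqP; rewrite eq_le j00 D0.
rewrite [X in (X `^ _)%:E](_ : _ = 0); last by rewrite (bigD1 j0) //= Dj0 mul0r.
rewrite powR0 ?invr_neq0 ?pnatr_eq0 -?lt0n //.
apply/lee_addgt0Pr => e e0; rewrite add0e.
pose C := \prod_(j < d | j != j0) (g j b - g j a + 1).
have C0 : 0 < C by apply: prodr_gt0 => j _; have := D0 j; lra.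
(* Chosen so that the [d]-th root of [eta ^+ d * C] is [e]. *)
pose eta := e / (C `^ d%:R^-1).
have eta0 : 0 < eta by rewrite divr_gt0 // powR_gt0.
pose delta j := if j == j0 then eta ^+ d else g j b - g j a + 1.
have dl j : 0 < delta j.
  by rewrite /delta; case: ifP => _; [exact: exprn_gt0|have := D0 j; lra].
apply: le_trans (@integral_speed_le_prod delta a b a0 ab b1 dl _) _.
  move=> j; rewrite /delta; case: eqP => [->|_]; last lra.
  by rewrite Dj0 exprn_ge0 // ltW.
rewrite lee_fin (bigD1 j0) //= {1}/delta eqxx.
rewrite (eq_bigr (fun j => g j b - g j a + 1)); last by move=> j /negbTE nj; rewrite /delta nj.
rewrite -/C powRM ?exprn_ge0 ?(ltW eta0) ?(ltW C0) // root_powR ?(ltW eta0) //.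
by rewrite /eta divfK // gt_eqF // powR_gt0.
Qed.

End Curves.

(** * The partition of the unit cube into cells *)

Section Cells.
Context {R : realType} {d L : nat}.
Hypothesis hL : (0 < L)%N.
Implicit Types (x y : pt R d) (k : {ffun 'I_d -> 'I_L}).

Let L0 : (0 : R) < L%:R. Proof. by rewrite ltr0n. Qed.

Lemma cell_lt k k' x y i : (k i < k' i)%N -> cell k x -> cell k' y -> x i < y i.
Proof.
move=> lt /(_ i)/andP[_ h] /(_ i)/andP[h' _].
by rewrite -(ltr_pM2l L0); apply: lt_le_trans h (le_trans _ h'); rewrite ler_nat.
Qed.

Lemma cell_inj k k' x : cell k x -> cell k' x -> k = k'.
Proof.
move=> h h'; apply/ffunP => i; apply/val_inj/eqP; rewrite /= eqn_leq.
by apply/andP; split; rewrite leqNgt; apply/negP => lt;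
  [have := cell_lt lt h' h|have := cell_lt lt h h']; rewrite ltxx.
Qed.

Lemma cell_unit_cube k x : cell k x -> unit_cube x.
Proof.
move=> h i; have /andP[h1 h2] := h i.
rewrite -(pmulr_rge0 _ L0) (le_trans _ h1) ?ler0n //=.
by rewrite -(ltr_pM2l L0) mulr1 (lt_le_trans h2) // ler_nat.
Qed.

Lemma unit_cube_cell x : unit_cube x -> exists k, cell k x.
Proof.
move=> ux; have lt i : (Num.trunc (L%:R * x i) < L)%N.
  have /andP[x0 x1] := ux i; rewrite truncn_lt_nat ?mulr_ge0 ?ler0n //.
  by rewrite -[ltRHS]mulr1 ltr_pM2l.
exists [ffun i => Ordinal (lt i)] => i; rewrite ffunE /=.
by apply: truncn_itv; have /andP[x0 _] := ux i; rewrite mulr_ge0 ?ler0n.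
Qed.

Lemma cell_corner k : cell k (fun i => (k i)%:R / L%:R : R).
Proof. by move=> i; rewrite mulrC divfK ?gt_eqF // lexx ltr_nat ltnSn. Qed.

End Cells.

(** * The boxes that a curve determines in the cells *)

Section CurveBoxes.
Context {R : realType} {d L : nat}.
Hypotheses (hd : (0 < d)%N) (hL : (0 < L)%N).
Variable f : pt R d -> R.
Hypothesis f_pc : piecewise_constant L f.
Hypothesis f_ge0 : forall x, unit_cube x -> 0 <= f x.
Hypothesis f_out : forall x, ~ unit_cube x -> f x = 0.
Variable g : 'I_d -> R -> R.
Hypothesis adm : admissible g.
Implicit Types (k : {ffun 'I_d -> 'I_L}).
Let mu := @lebesgue_measure R.

Let L0 : (0 : R) < L%:R. Proof. by rewrite ltr0n. Qed.

Lemma cell_val_ge0 k : 0 <= cell_val f k.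
Proof. by apply/f_ge0/(cell_unit_cube hL (k := k))/cell_corner. Qed.

Definition visit k : set R := [set t | t \in `[0, 1] /\ cell k (fun j => g j t)].

(** Each coordinate of the curve is nondecreasing, so a bound met at two times is met in between. *)
Lemma visit_interval k : is_interval (visit k).
Proof.
move=> s t [s01 cs] [t01 ct] u /andP[su ut].
move: s01 t01; rewrite !in_itv /= => /andP[s0 s1] /andP[t0 t1].
have u0 := le_trans s0 su; have u1 := le_trans ut t1.
split; first by rewrite in_itv /= u0.
move=> i; have /andP[h1 _] := cs i; have /andP[_ h2] := ct i.
apply/andP; split.
  by apply: le_trans h1 _; rewrite ler_pM2l // admissible_mono.
by apply: le_lt_trans h2; rewrite ler_pM2l // admissible_mono.
Qed.

Lemma measurable_visit k : measurable (visit k).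
Proof. by apply: is_interval_measurable; exact: visit_interval. Qed.

Let enter k := inf (visit k).
Let leave k := sup (visit k).

Lemma visit_bounds k : has_lbound (visit k) /\ has_ubound (visit k).
Proof. by split; [exists 0|exists 1] => t [+ _]; rewrite in_itv /= => /andP[]. Qed.

Lemma visit_sub k : visit k `<=` `[enter k, leave k]%classic.
Proof.
move=> t kt; have [lb ub] := visit_bounds k.
by rewrite /= in_itv /= ge_inf // ub_le_sup.
Qed.

Lemma enter_leave k : visit k !=set0 -> [/\ 0 <= enter k, enter k <= leave k & leave k <= 1].
Proof.
move=> ne; split.
- by apply: lb_le_inf => // t [+ _]; rewrite in_itv /= => /andP[].
- by have [t /visit_sub] := ne; rewrite /= in_itv /= => /andP[]; exact: le_trans.
- by apply: ge_sup => // t [+ _]; rewrite in_itv /= => /andP[].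
Qed.

(** A violation at the infimum would persist nearby by continuity, yet visit times occur arbitrarily
    close to it. *)
Lemma enter_cell k i : visit k !=set0 -> (k i)%:R / L%:R <= g i (enter k).
Proof.
move=> ne; have [e0 el l1] := enter_leave ne; rewrite leNgt; apply/negP => lt.
have c : g i x @[x --> enter k] --> g i (enter k).
  by apply: admissible_continuous adm _ _ _; rewrite e0 (le_trans el).
have near_enter : nbhs (enter k) (fun x => g i x < (k i)%:R / L%:R) 
  by exact: (cvgr_lt _ c).
have [e /= e_gt0 He] := (nbhs_ballP _ _).1 near_enter.
have [lb ub] := visit_bounds k.
have [t kt te] := inf_adherent e_gt0 (conj ne lb).
have /andP[h _] := kt.2 i; have et := ge_inf lb kt.
have /He : ball (enter k) e t.
  by rewrite /ball /= ltr_distlC; apply/andP; split; rewrite /enter; lra.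
by rewrite ltNge ler_pdivrMr // mulrC h.
Qed.

(** Same argument at the supremum. The bound is weak because the cell is half-open and the curve may
    be outside it at time [leave k]. *)
Lemma leave_cell k i : visit k !=set0 -> g i (leave k) <= (k i).+1%:R / L%:R.
Proof.
move=> ne; have [e0 el l1] := enter_leave ne; rewrite leNgt; apply/negP => lt.
have c : g i x @[x --> leave k] --> g i (leave k).
  by apply: admissible_continuous adm _ _ _; rewrite l1 (le_trans e0).
have near_leave : nbhs (leave k) (fun x => (k i).+1%:R / L%:R < g i x) 
  by exact: (cvgr_gt _ c).
have [e /= e_gt0 He] := (nbhs_ballP _ _).1 near_leave.
have [lb ub] := visit_bounds k.
have [t kt te] := sup_adherent e_gt0 (conj ne ub).
have /andP[_ h] := kt.2 i; have et := ub_le_sup ub kt.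
have /He : ball (leave k) e t.
  by rewrite /ball /= ltr_distlC; apply/andP; split; rewrite /leave; lra.
by rewrite ltNge ler_pdivlMr // mulrC ltW.
Qed.

Definition box_lo k : pt R d := fun i => g i (enter k).
Definition box_hi k : pt R d := fun i => g i (leave k).

(** Distinct cells differ in a coordinate [i], and monotonicity of [g i] puts all visits of one
    before all visits of the other. So one is left no later than the other is entered, which orders
    every coordinate. *)
Lemma visited_boxes_ordered k k' : visit k !=set0 -> visit k' !=set0 -> k != k' ->
  (forall i, box_hi k i <= box_lo k' i) \/ (forall i, box_hi k' i <= box_lo k i).
Proof.
move=> ne ne' /eqP kk'.
have [i ki] : exists i, k i != k' i.
  apply/existsP; apply: contra_notT kk'; rewrite negb_exists => /forallP e.
  by apply/ffunP => i; have := e i; rewrite negbK => /eqP.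
wlog lt : k k' ne ne' {kk' ki} / (k i < k' i)%N => [W|].
  have : (k i < k' i)%N || (k' i < k i)%N by rewrite -neq_ltn.
  by case/orP => lt; [exact: W|by apply/or_comm; exact: W].
left => j; have [e0 el l1] := enter_leave ne; have [e0' el' l1'] := enter_leave ne'.
have l0 := le_trans e0 el; have e1' := le_trans el' l1'.
apply: (admissible_mono adm) => //.
apply: ge_sup => // s ks; apply: lb_le_inf => // t kt; rewrite leNgt; apply/negP => ts.
have := cell_lt hL lt ks.2 kt.2; rewrite ltNge => /negP; apply.
apply: (admissible_mono adm); [|exact: ltW|].
  by have := kt.1; rewrite in_itv => /andP[].
by have := ks.1; rewrite in_itv => /andP[].
Qed.

Definition visited : {pred {ffun 'I_d -> 'I_L}} := [pred k | `[< visit k !=set0 >]].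

Let piece k : R -> \bar R := fun t => ((cell_val f k) `^ d%:R^-1 * speed g t)%:E.

(** The cells partition the unit cube, so at most one term survives; outside the cube both sides are
    zero. *)
Lemma Jintegrand_pieces t : t \in `[0, 1] ->
  (Jintegrand f g t)%:E = (\sum_(k : {ffun 'I_d -> 'I_L}) (piece k \_ (visit k)) t)%E.
Proof.
move=> t01; rewrite /Jintegrand -/(speed g t).
have [u|nu] := pselect (unit_cube (fun j => g j t)).
  have [k kt] := unit_cube_cell hL u.
  rewrite (bigD1 k) //= big1 ?adde0.
    rewrite /patch mem_set //; congr (_ `^ _ * _)%:E.
    by apply: (f_pc (k := k)) => //; exact: cell_corner.
  move=> k' /eqP ne; rewrite /patch memNset // => -[_ kt'].
  by apply: ne; exact: cell_inj hL _ _ _ kt' kt.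
rewrite f_out // powR0 ?mul0r ?invr_neq0 ?pnatr_eq0 -?lt0n // big1 // => k _.
by rewrite /patch memNset // => -[_ kt]; apply: nu; exact: cell_unit_cube kt.
Qed.

(** On [visit k] the density factor is constant, and enlarging the visit to [[enter k, leave k]]
    only increases the integral of a nonnegative function. [integral_speed_le] then yields the root
    of density times volume. *)
Lemma Jfun_le_boxes :
  (Jfun f g <= (\sum_(k in visited)
     pc_box_integral L f (box_lo k) (box_hi k) `^ d%:R^-1)%:E)%E.
Proof.
have mp k : measurable_fun (`[0, 1]%classic : set R) (piece k).
  by apply/measurable_EFinP; apply: measurable_funM => //; exact: measurable_speed.
have p0 k t : (0 <= piece k t)%E by rewrite lee_fin mulr_ge0 ?powR_ge0.
have -> : Jfun f g =
   (\int[mu]_(t in `[0%R, 1%R]) \sum_(k : {ffun 'I_d -> 'I_L}) (piece k \_ (visit k)) t)%E.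
  by apply: eq_integral => t; rewrite inE => t01; exact: Jintegrand_pieces.
rewrite ge0_integral_sum //; last 2 first.
- move=> k; apply/(measurable_restrict _ (measurable_visit k)) => //.
  by apply: measurable_funS (mp k) => //; exact: subIsetl.
- by move=> k t _; rewrite /patch; case: ifP.
rewrite -sumEFin [leRHS]big_mkcond /=; apply: lee_sum => k _.
rewrite -integral_mkcondr; case: ifPn => [/asboolP ne|/asboolPn no]; last first.
  have -> : visit k = set0 by apply/seteqP; split => t // kt; case: no; exists t.
  by rewrite setI0 integral_set0.
have [e0 el l1] := enter_leave ne.
have sub := subset_itv01 e0 l1.
have mp' : measurable_fun (`[enter k, leave k]%classic : set R) (piece k).
  by apply: measurable_funS (mp k).
apply: (@le_trans _ _ (\int[mu]_(t in `[enter k, leave k]) piece k t)%E).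
  apply: ge0_subset_integral => //; last by move=> t [_ /visit_sub].
  by apply: measurableI => //; exact: measurable_visit.
rewrite /piece; under eq_integral do rewrite EFinM.
rewrite ge0_integralZl_EFin ?powR_ge0 //; last 2 first.
- by move=> t _; rewrite lee_fin powR_ge0.
- by apply/measurable_EFinP; apply: measurable_funS (measurable_speed adm).
rewrite (@pc_box_integral_in_cell R d L hL f k); last 2 first.
- by move=> i; exact: enter_cell.
- by move=> i; exact: leave_cell.
rewrite powRM ?cell_val_ge0 ?prodr_ge0 //; last by move=> i _; rewrite le_max lexx.
rewrite EFinM lee_wpmul2l ?lee_fin ?powR_ge0 //.
apply: le_trans (integral_speed_le hd adm e0 el l1) _; rewrite lee_fin.
rewrite (eq_bigr (fun j => Num.max 0 (box_hi k j - box_lo k j))) // => j _.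
by rewrite (max_idPr _) // subr_ge0 admissible_mono.
Qed.

End CurveBoxes.

(** * The lower bound *)

Lemma limn_einf_ge (R : realType) (u : nat -> \bar R) (x : \bar R) :
  (\forall n \near \oo, (x <= u n)%E) -> (x <= limn_einf u)%E.
Proof.
move=> [N _ HN]; rewrite limn_einf_lim; apply: lime_ge; first exact: is_cvg_einfs.
exists N => // n /= Nn; apply: le_ereal_inf_tmp => _ [m /= nm <-].
by apply: HN; exact: leq_trans nm.
Qed.

Section LowerBound.
Context {R : realType} {d L : nat}.
Hypotheses (hd : (0 < d)%N) (hL : (0 < L)%N).
Variable f : pt R d -> R.
Hypothesis f_pc : piecewise_constant L f.
Hypothesis f_ge0 : forall x, unit_cube x -> 0 <= f x.
Hypothesis f_out : forall x, ~ unit_cube x -> f x = 0.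
Hypothesis f_prob : pc_box_integral L f (fun _ => 0) (fun _ => 1) = 1.
Context {dT : measure_display} {T : measurableType dT}.
Variables (P : probability T R) (X : nat -> T -> pt R d).
Hypothesis hX : iid_boxlaw P X (pc_box_integral L f).
Variable cd : R.
Hypothesis hcd : forall U : nat -> T -> pt R d, iid_boxlaw P U (@unif_box R d) ->
  {ae P, forall w, (scaled_chain (fun m => U m w) @ \oo --> cd)}.
Implicit Types (k : {ffun 'I_d -> 'I_L}) (A B : pt R d).

(** [hcd] says something about [cd] only through a uniform sequence on [T]. One is obtained from the
    hits in a full cell of positive density, which exists because the total mass is 1. *)
Lemma limit_constant_ge0 : 0 <= cd.
Proof.
have [k fk] : exists k, cell_val f k != 0.
  apply: contrapT => no; have /esym/eqP := f_prob; rewrite /pc_box_integral big1.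
    by rewrite oner_eq0.
  move=> k _; have [fk|fk] := eqVneq (cell_val f k) 0; last by case: no; exists k.
  by rewrite [f _]fk mul0r.
pose A : pt R d := fun i => (k i)%:R / L%:R.
pose B : pt R d := fun i => (k i).+1%:R / L%:R.
have AB i : A i < B i by rewrite /A /B ltr_pM2r ?invr_gt0 ?ltr0n // ltr_nat.
have p0 : 0 < pc_box_integral L f A B.
  rewrite (@pc_box_integral_in_cell R d L hL f k) // mulr_gt0 //.
    by rewrite lt_neqAle eq_sym fk (cell_val_ge0 hL).
  by apply: prodr_gt0 => i _; rewrite lt_max subr_gt0 AB orbT.
have iid := hit_seq_iid hX f_prob AB p0
  (@pc_subbox R d L hL f k A B (fun=> lexx _) (fun=> lexx _) AB).
exact: scaled_chain_cvg_ge0 (hcd iid).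
Qed.

(** Positive mass forces [A i < B i], and [box_chain_liminf] applies; for a box of mass zero the
    bound only concerns negative [eta]. *)
Lemma cell_box_chain_liminf k A B :
  (forall i, (k i)%:R / L%:R <= A i) -> (forall i, B i <= (k i).+1%:R / L%:R) ->
  {ae P, forall w (eta : R), eta < cd * pc_box_integral L f A B `^ d%:R^-1 ->
    \forall n \near \oo, eta <= n%:R `^ (- d%:R^-1) * (box_chain A B (X ^~ w) n)%:R}.
Proof.
move=> kA kB; have pE := @pc_box_integral_in_cell R d L hL f k A B kA kB.
have M0 : 0 <= \prod_(i < d) Num.max 0 (B i - A i).
  by apply: prodr_ge0 => i _; rewrite le_max lexx.
have p_ge0 : 0 <= pc_box_integral L f A B.
  by rewrite pE mulr_ge0 // (cell_val_ge0 hL).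
have [p0|p0] := ltP 0 (pc_box_integral L f A B); last first.
  have -> : pc_box_integral L f A B = 0 by apply/eqP; rewrite eq_le p0 p_ge0.
  apply: filterE => w eta; rewrite powR0 ?mulr0 ?invr_neq0 ?pnatr_eq0 -?lt0n // => eta0.
  by apply: nearW => n; rewrite (le_trans (ltW eta0)) // mulr_ge0 ?powR_ge0.
have AB i : A i < B i.
  rewrite ltNge; apply/negP => BA; move: p0; rewrite pE (bigD1 i) //=.
  by rewrite (max_idPl _) ?subr_le0 // mul0r mulr0 ltxx.
have iid := hit_seq_iid hX f_prob AB p0 (@pc_subbox R d L hL f k A B kA kB AB).
exact: (box_chain_liminf hX f_prob AB p0 (hcd iid) hd).
Qed.

Lemma curve_liminf (g : 'I_d -> R -> R) : admissible g ->
  {ae P, forall w, (cd%:E * Jfun f g <=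
     limn_einf (fun n => (scaled_chain (fun m => X m w) n)%:E))%E}.
Proof.
move=> adm; pose lo := @box_lo R d L g; pose hi := @box_hi R d L g.
pose V := @visited R d L g; pose p k := pc_box_integral L f (lo k) (hi k).
have chains k : {ae P, forall w, k \in V -> forall eta : R, eta < cd * p k `^ d%:R^-1 ->
    \forall n \near \oo, eta <= n%:R `^ (- d%:R^-1) * (box_chain (lo k) (hi k) (X ^~ w) n)%:R}.
  case: (boolP (k \in V)) => [/asboolP ne|nV].
    have ak i : (k i)%:R / L%:R <= lo k i by exact: enter_cell.
    have bk i : hi k i <= (k i).+1%:R / L%:R by exact: leave_cell.
    by apply: filterS (cell_box_chain_liminf ak bk) => w H _.
  by apply: filterE => w kV; case/negP: nV.
have all_k : {ae P, forall w k, k \in V -> forall eta : R, eta < cd * p k `^ d%:R^-1 ->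
    \forall n \near \oo, eta <= n%:R `^ (- d%:R^-1) * (box_chain (lo k) (hi k) (X ^~ w) n)%:R}.
  by apply: filter_forall => k; exact: chains.
apply: filterS all_k => w {}chains.
have cd0 := limit_constant_ge0.
apply: (@le_trans _ _ (cd%:E * (\sum_(k in V) p k `^ d%:R^-1)%:E)%E).
  by apply: lee_wpmul2l; [rewrite lee_fin|exact: Jfun_le_boxes].
rewrite -EFinM; apply/lee_addgt0Pr => e e0; rewrite -leeBlDr // -EFinB.
apply: limn_einf_ge.
(* Each visited cell gives up [e / N], in total at most [e]; the added 1 keeps [N] positive if no
   cell is visited. *)
pose N : R := #|V|%:R + 1; have N0 : 0 < N by rewrite /N ltr_wpDl.
pose eta k := cd * p k `^ d%:R^-1 - e / N.
have all_chains : \forall n \near \oo, forall k, k \in V ->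
    eta k <= n%:R `^ (- d%:R^-1) * (box_chain (lo k) (hi k) (X ^~ w) n)%:R.
  apply: filter_forall => k; case: (boolP (k \in V)) => kV; last exact: nearW.
  have := chains k kV (eta k); rewrite {1}/eta ltrBlDr ltrDl divr_gt0 // => /(_ isT).
  by apply: filterS => n H _.
apply: filterS all_chains => n H; rewrite lee_fin.
have ord : {in V &, forall k k', k != k' ->
     (forall i, hi k i <= lo k' i) \/ (forall i, hi k' i <= lo k i)}.
  move=> k k' /asboolP ne /asboolP ne'; exact: visited_boxes_ordered.
have sum := box_chain_sum hd (X ^~ w) n ord.
rewrite /scaled_chain; apply: (@le_trans _ _ (n%:R `^ (- d%:R^-1) *
   (\sum_(k in V) box_chain (lo k) (hi k) (X ^~ w) n)%:R)); last first.
  by rewrite ler_wpM2l ?powR_ge0 // ler_nat.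
rewrite natr_sum [leRHS]mulr_sumr; apply: (@le_trans _ _ (\sum_(k in V) eta k)); last first.
  apply: ler_sum => k kV; exact: H.
rewrite /eta sumrB -mulr_sumr lerB // sumr_const -mulr_natr mulrAC.
by rewrite ler_pdivrMr // ler_pM2l // /N lerDl.
Qed.

(** Each box contributes the root of a probability, hence at most 1. This makes [Jbar f] finite, so
    that curves within any [1 / (n + 1)] of it exist. *)
Lemma Jfun_le_card (g : 'I_d -> R -> R) : admissible g ->
  (Jfun f g <= #|{ffun 'I_d -> 'I_L}|%:R%:E)%E.
Proof.
move=> adm; apply: le_trans (Jfun_le_boxes hd hL f_pc f_ge0 f_out adm) _.
rewrite lee_fin -sum1_card natr_sum [leLHS]big_mkcond; apply: ler_sum => k _.
case: ifP => // _; rewrite -[leRHS](_ : 1 `^ d%:R^-1 = 1); last by rewrite powR1.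
set p := pc_box_integral _ _ _ _.
by apply: ge0_ler_powR; rewrite ?nnegrE ?invr_ge0 // /p;
  [exact: mu_box_ge0 hX f_prob _ _|exact: mu_box_le1 hX f_prob _ _].
Qed.

(** The null set of [curve_liminf] depends on the curve, so the supremum is approached along one
    sequence of curves fixed beforehand. *)
Lemma Jbar_liminf : {ae P, forall w, (cd%:E * Jbar f <=
     limn_einf (fun n => (scaled_chain (fun m => X m w) n)%:E))%E}.
Proof.
have cd0 := limit_constant_ge0.
(* Over an empty class the supremum is [-oo], and its product with [cd >= 0] is at most 0. *)
have [[g0 adm0]|none] := pselect (exists g : 'I_d -> R -> R, admissible g); last first.
  have -> : Jbar f = -oo%E.
    rewrite /Jbar (_ : [set _ | _ in _] = set0) ?ereal_sup0 //.
    by rewrite -subset0 => x [g adm _]; case: none; exists g.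
  apply: filterE => w; apply: (@le_trans _ _ 0%E).
    by rewrite mule_ge0_le0 // lee_fin.
  by apply: limn_einf_ge; apply: nearW => n; rewrite lee_fin mulr_ge0 ?powR_ge0.
have J0 : (0 <= Jfun f g0)%E.
  by apply: integral_ge0 => t _; rewrite lee_fin mulr_ge0 ?powR_ge0.
have fin : Jbar f \is a fin_num.
  rewrite fin_numElt; apply/andP; split.
    apply: (@lt_le_trans _ _ 0%E) => //; apply: le_trans J0 _.
    by apply: ereal_sup_ubound; exists g0.
  apply: (@le_lt_trans _ _ #|{ffun 'I_d -> 'I_L}|%:R%:E); last exact: ltry.
  by apply: ge_ereal_sup => _ [g adm <-]; exact: Jfun_le_card.
have near_sup n : exists g : 'I_d -> R -> R, admissible g /\
    (Jbar f - (n.+1%:R^-1)%:E < Jfun f g)%E.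
  have n0 : (0 : R) < n.+1%:R^-1 by rewrite invr_gt0.
  by have [_ [g adm <-] lt] := ub_ereal_sup_adherent n0 fin; exists g.
have [g /all_and2 [adm lt]] := all_sig (fun n => cid (near_sup n)).
have all_g := ae_foralln (fun n => curve_liminf (adm n)).
apply: filterS all_g => w H; rewrite -(fineK fin) -EFinM; set j := fine _.
apply/lee_addgt0Pr => e e0; pose n := Num.bound (cd / e).
have ce0 : 0 <= cd / e by rewrite divr_ge0 // ltW.
have cn : cd / n.+1%:R <= e.
  rewrite ler_pdivrMr // mulrC -ler_pdivrMr //; apply: ltW.
  by apply: lt_le_trans (archi_boundP ce0) _; rewrite ler_nat.
rewrite -leeBlDr // -EFinB; apply: le_trans (H n).
apply: (@le_trans _ _ (cd%:E * (j - n.+1%:R^-1)%:E)%E).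
  by rewrite -EFinM lee_fin mulrBr lerB.
apply: lee_wpmul2l; first by rewrite lee_fin.
by apply: ltW; move: (lt n); rewrite -(fineK fin) -EFinB.
Qed.

End LowerBound.

Theorem theorem3p1 (R : realType) (d L : nat) (hd : (2 <= d)%N) (hL : (0 < L)%N)
  (cd : R)
  (hcd : forall (dT' : measure_display) (T' : measurableType dT')
           (P' : probability T' R) (U : nat -> T' -> pt R d),
      iid_boxlaw P' U (@unif_box R d) ->
      {ae P', forall w, (scaled_chain (fun m => U m w) @ \oo --> cd)})
  (f : pt R d -> R)
  (f_pc : piecewise_constant L f)
  (f_ge0 : forall x, unit_cube x -> 0 <= f x)
  (f_out : forall x, ~ unit_cube x -> f x = 0)
  (f_prob : pc_box_integral L f (fun _ => 0) (fun _ => 1) = 1)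
  (dT : measure_display) (T : measurableType dT) (P : probability T R)
  (X : nat -> T -> pt R d)
  (hX : iid_boxlaw P X (pc_box_integral L f)) :
  {ae P, forall w,
     (cd%:E * Jbar f <= limn_einf (fun n => (scaled_chain (fun m => X m w) n)%:E))%E}.
Proof.
exact: (Jbar_liminf (ltnW hd) hL f_pc f_ge0 f_out f_prob hX (hcd dT T P)).
Qed.
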